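(* Let $\pi$ be a probability density on $\mathbb{R}^d$ with $\pi(x)>0$ for all $x$ and $\log\pi\in C^1(\mathbb{R}^d)$, and for $\lambda>0$ let $\pi^{(\lambda)}(x):=\lambda^{-1}\pi(x_1/\lambda,x_2,\dots,x_d)$. Let $\mu_0$ be a symmetric probability density on $\mathbb{R}$ and $\mu(\xi)=\prod_{i=1}^d\mu_0(\xi_i)$, and assume $\mu$ satisfies: there exists $\lambda_0>0$ such that for all $x,y\in\mathbb{R}^d$ and $\lambda<\lambda_0$, $\mu(\delta_\lambda)\ge\mu(\delta)$, where $\delta=y-x$ and $\delta_\lambda=(\lambda(y_1-x_1),y_2-x_2,\dots,y_d-x_d)$; and $\sup_{\xi_1\in\mathbb{R}}\mu_1(\xi_1)<\infty$ where $\mu_1$ is the first marginal of $\mu$. Fix $\sigma>0$ and let $P^B_\lambda$ be the Metropolis--Hastings kernel with target $\pi^{(\lambda)}$ and Barker candidate density $q^B_\lambda(x,y)=\prod_{i=1}^d\frac{2\sigma^{-1}\mu_0((y_i-x_i)/\sigma)}{1+e^{-\partial_i\log\pi^{(\lambda)}(x)(y_i-x_i)}}$; write $P^B=P^B_1$. Assume $\mathrm{Gap}(P^B)>0$. Then $\mathrm{Gap}(P^B_\lambda)=\Theta(\lambda)$ as $\lambda\downarrow0$.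
   Context: Metropolis--Hastings kernel with target $\pi$ and candidate density $q(x,y)$: propose $y\sim q(x,\cdot)$, accept with probability $\min\{1,\pi(y)q(y,x)/(\pi(x)q(x,y))\}$, else stay. $\mathrm{Gap}(P)=\inf_{f\in L^2_{0,1}(\pi)}\frac12\int (f(y)-f(x))^2\pi(dx)P(x,dy)$ with $L^2_{0,1}(\pi)=\{f:\mathbb{E}_\pi f=0,\mathrm{Var}_\pi f=1\}$. $F=\Theta(G)$ as $\lambda\downarrow0$ means $\liminf F/G>0$ and $\limsup F/G<\infty$. $\partial_i$ denotes partial derivative in the $i$-th coordinate. *)

(* Defs.v *)
From HB Require Import structures.
From mathcomp Require Import all_boot all_order all_algebra.
From mathcomp Require Import all_classical all_reals all_analysis.
Set Implicit Arguments. Unset Strict Implicit. Unset Printing Implicit Defensive.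
Import Order.TTheory GRing.Theory Num.Theory.
Import numFieldNormedType.Exports.
Local Open Scope classical_set_scope.
Local Open Scope ring_scope.

Section defs.
Variable R : realType.

(* Lebesgue integral over R^n (points are row vectors 'rV[R]_n), realised as the
   iterated one-dimensional Lebesgue integral (Lebesgue measure on R^n being the
   n-fold product of the one-dimensional Lebesgue measure). *)
Fixpoint iint (n : nat) : ('rV[R]_n -> \bar R) -> \bar R :=
  match n with
  | 0 => fun f => f 0
  | n'.+1 => fun f =>
      (\int[@lebesgue_measure R]_t iint (fun v : 'rV[R]_n' =>
          f (row_mx (const_mx t : 'rV[R]_1) v)))%E
  end.

Definition borel_fun (n : nat) (f : 'rV[R]_n -> R) : Prop :=
  forall B : set R, measurable B -> <<s [set U : set 'rV[R]_n | open U] >> (f @^-1` B).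

Definition ebasis (n : nat) (i : 'I_n) : 'rV[R]_n := delta_mx 0 i.
Definition partial (n : nat) (i : 'I_n) (f : 'rV[R]_n -> R) (x : 'rV[R]_n) : R :=
  derive f x (ebasis i).

Definition C1 (n : nat) (f : 'rV[R]_n -> R) : Prop :=
  (forall i x, derivable f x (ebasis i)) /\ (forall i, continuous (partial i f)).

Definition prob_density (n : nat) (p : 'rV[R]_n -> R) : Prop :=
  borel_fun p /\ (forall x, 0 <= p x) /\ iint (fun x => (p x)%:E) = 1%E.

Definition scale1 (n : nat) (c : R) (x : 'rV[R]_n.+1) : 'rV[R]_n.+1 :=
  \row_i (if i == ord0 then c * x 0 i else x 0 i).

Definition pi_scaled (n : nat) (p : 'rV[R]_n.+1 -> R) (l : R) (x : 'rV[R]_n.+1) : R :=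
  l^-1 * p (scale1 l^-1 x).

Definition prod_density (n : nat) (mu0 : R -> R) (xi : 'rV[R]_n) : R :=
  \prod_(i < n) mu0 (xi 0 i).

Definition marginal1 (n : nat) (m : 'rV[R]_n.+1 -> R) (t : R) : \bar R :=
  iint (fun v : 'rV[R]_n => (m (row_mx (const_mx t : 'rV[R]_1) v))%:E).

Definition barker_q (n : nat) (mu0 : R -> R) (sigma : R) (p : 'rV[R]_n -> R)
    (x y : 'rV[R]_n) : R :=
  \prod_(i < n) ((2 * sigma^-1 * mu0 ((y 0 i - x 0 i) / sigma)) /
     (1 + expR (- (partial i (fun z => ln (p z)) x) * (y 0 i - x 0 i)))).

Definition mh_accept (n : nat) (p : 'rV[R]_n -> R) (q : 'rV[R]_n -> 'rV[R]_n -> R)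
    (x y : 'rV[R]_n) : R :=
  Num.min 1 ((p y * q y x) / (p x * q x y)).

(* Metropolis--Hastings kernel P(x,dy) = q(x,y) a(x,y) dy + r(x) delta_x(dy),
   r(x) = 1 - int q(x,y) a(x,y) dy, given through its integral
   int g(y) P(x,dy) of a nonnegative function g. *)
Definition mh_int (n : nat) (p : 'rV[R]_n -> R) (q : 'rV[R]_n -> 'rV[R]_n -> R)
    (x : 'rV[R]_n) (g : 'rV[R]_n -> \bar R) : \bar R :=
  (iint (fun y => g y * (q x y * mh_accept p q x y)%:E)
   + (1 - iint (fun y => (q x y * mh_accept p q x y)%:E)) * g x)%E.

Definition expect (n : nat) (p : 'rV[R]_n -> R) (f : 'rV[R]_n -> R) : \bar R :=
  iint (fun x => (p x * f x)%:E).
Definition variance (n : nat) (p : 'rV[R]_n -> R) (f : 'rV[R]_n -> R) : \bar R :=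
  iint (fun x => (p x * (f x - fine (expect p f)) ^+ 2)%:E).

Definition L2_01 (n : nat) (p : 'rV[R]_n -> R) : set ('rV[R]_n -> R) :=
  [set f | borel_fun f /\ expect p f = 0%E /\ variance p f = 1%E].

Definition dirichlet (n : nat) (p : 'rV[R]_n -> R) (q : 'rV[R]_n -> 'rV[R]_n -> R)
    (f : 'rV[R]_n -> R) : \bar R :=
  ((2^-1)%:E * iint (fun x => (p x)%:E *
      mh_int p q x (fun y => ((f y - f x) ^+ 2)%:E)))%E.

Definition mh_gap (n : nat) (p : 'rV[R]_n -> R) (q : 'rV[R]_n -> 'rV[R]_n -> R) : \bar R :=
  ereal_inf [set dirichlet p q f | f in L2_01 p].

Definition barker_gap (n : nat) (p : 'rV[R]_n.+1 -> R) (mu0 : R -> R) (sigma l : R) : \bar R :=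
  mh_gap (pi_scaled p l) (barker_q mu0 sigma (pi_scaled p l)).

End defs.

(* Main.v *)
Require Import Defs.
From HB Require Import structures.
From mathcomp Require Import all_boot all_order all_algebra.
From mathcomp Require Import all_classical all_reals all_analysis.
From mathcomp Require Import measurable_realfun.
Import Order.TTheory GRing.Theory Num.Theory.
Import numFieldNormedType.Exports.
Local Open Scope classical_set_scope.
Local Open Scope ring_scope.
Set Implicit Arguments. Unset Strict Implicit. Unset Printing Implicit Defensive.

(* Rescaling the first coordinate, x = S_l u, turns the Dirichlet form of the
   kernel with target pi^(l) into l times the form
     1/2 int int (g v - g u)^2 (2/sigma)^d mu(S_l (v - u) / sigma)
                 min (pi u B(u,v), pi v B(v,u)) du dv,     g = f o S_l,
   where B(u,v) is the product of the logistic factors of the Barker proposal: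
   in d_i log pi^(l)(x) (y_i - x_i) the factors l cancel, so l survives only in
   mu.  The monotonicity assumption on mu makes this form at least the one for
   l = 1, hence Gap_l >= l Gap_1.  For the upper bound the form is evaluated at
   a function g taking one value on the slab 0 <= u_1 <= 1 and another off it:
   only pairs with u or v in the slab contribute, and since mu_0 is bounded
   their total flow is bounded uniformly in l. *)

(** * Borel functions and iterated Lebesgue integrals on row vectors *)

Section borel_row.
Variable R : realType.

Local Notation borelRow n := (g_sigma_algebraType [set U : set 'rV[R]_n | open U]).

(** * Measurability of maps from and into row vectors *)

Lemma borel_funP n (f : 'rV[R]_n -> R) :
  borel_fun f <-> measurable_fun (setT : set (borelRow n)) f.
Proof.
split=> [bf _ B mB|mf B mB]; first by rewrite setTI; exact: bf.
by have := mf measurableT B mB; rewrite setTI.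
Qed.

(** Every open set is the union of the countably many boxes with rational centre and radius
    [1/(k+1)] that it contains, and the preimage of a box is a finite intersection of preimages of
    intervals under the coordinates of [f]. *)
Lemma measurable_of_row_coord d (X : measurableType d) n (f : X -> borelRow n) :
  (forall i, measurable_fun setT (fun x => (f x : 'rV[R]_n) 0 i)) ->
  measurable_fun setT f.
Proof.
move=> mf; apply: (@measurability _ _ X (borelRow n) setT f
  [set U : set 'rV[R]_n | open U] erefl).
move=> _ [U oU <-]; rewrite setTI.
pose box (c : 'rV[rat]_n * nat) : set 'rV[R]_n :=
  [set v | forall i, `|ratr (c.1 0 i) - v 0 i| < c.2.+1%:R^-1].
have -> : U = \bigcup_(c in [set c | box c `<=` U]) box c.
  apply/seteqP; split=> [v Uv|v [c /= cU cv]]; last exact: cU.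
  have /nbhs_ballP[e /= e0 eU] : nbhs v U by exact: open_nbhs_nbhs.
  (* Half of [e]: two points of one box are compared through its centre. *)
  have [k ke] : exists k : nat, k.+1%:R^-1 < e / 2.
    have e20 : 0 < e / 2 by rewrite divr_gt0.
    have [k _ /(_ _ (leqnn k)) h] := near_infty_natSinv_lt (PosNum e20).
    by exists k.
  have exq i : exists q : rat, `|ratr q - v 0 i| < k.+1%:R^-1.
    have [|q] := @rat_in_itvoo R (v 0 i - k.+1%:R^-1) (v 0 i + k.+1%:R^-1).
      by rewrite ltrD2l gtrN// invr_gt0.
    by rewrite in_itv/= => qv; exists q; rewrite ltr_distl.
  have [q qv] := choice exq.
  exists (\row_i q i, k); last by move=> i; rewrite mxE.
  move=> w cw; apply: eU; split=> // i j; rewrite (ord1 i) -ball_normE /ball_/=.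
  have := cw j; have := qv j; rewrite /= mxE => h1 h2.
  rewrite -(subrKA (ratr (q j))).
  apply: le_lt_trans (ler_normD _ _) _.
  by rewrite [e]splitr ltrD// (lt_trans _ ke)// distrC.
rewrite preimage_bigcup bigcup_mkcond.
apply: countable_bigcupT_measurable => [|c]; first exact: countableP.
case: ifP => // _.
have -> : f @^-1` box c = \bigcap_(i in [set: 'I_n])
    ((fun x => (f x : 'rV[R]_n) 0 i) @^-1`
      `]ratr (c.1 0 i) - c.2.+1%:R^-1, ratr (c.1 0 i) + c.2.+1%:R^-1[%classic).
  apply/seteqP; split=> [x bx i _|x bx i] /=.
    by rewrite in_itv/= -ltr_distl distrC; exact: bx.
  by have := bx i Logic.I; rewrite /= in_itv/= -ltr_distl distrC.
apply: fin_bigcap_measurable => // i _.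
by rewrite -[X in measurable X]setTI; exact: mf.
Qed.

Lemma continuous_borel n (f : 'rV[R]_n -> R) : continuous f ->
  measurable_fun (setT : set (borelRow n)) f.
Proof.
move=> /continuousP cf; apply: (measurability _ (RGenOpens.measurableE R)).
move=> _ [_ [a [b ->] <-]]; rewrite setTI.
by apply: sub_sigma_algebra; apply: cf; exact: interval_open.
Qed.

Lemma measurable_coord n i :
  measurable_fun (setT : set (borelRow n)) (fun v => (v : 'rV[R]_n) 0 i).
Proof. by apply: continuous_borel; exact: (@coord_continuous R 1 n 0 i). Qed.

Lemma measurable_row_coord d (X : measurableType d) n i (f : X -> borelRow n) :
  measurable_fun setT f -> measurable_fun setT (fun x => (f x : 'rV[R]_n) 0 i).
Proof. by move=> mf; exact: (measurableT_comp (measurable_coord i)). Qed.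

(** The point at which the recursive case of [iint] evaluates its integrand; [t] is the coordinate
    of the outermost integral. *)
Definition consrow n (t : R) (v : 'rV[R]_n) : 'rV[R]_n.+1 :=
  row_mx (const_mx t : 'rV[R]_1) v.

Lemma consrow0 n t (v : 'rV[R]_n) : consrow t v 0 0 = t.
Proof. by rewrite mxE; case: splitP => // j _; rewrite mxE. Qed.

Lemma consrowS n t (v : 'rV[R]_n) i : consrow t v 0 (lift ord0 i) = v 0 i.
Proof.
rewrite mxE; case: splitP => j; first by rewrite (ord1 j).
by rewrite lift0 add1n => -[] ij; congr (v _ _); apply/val_inj.
Qed.

Lemma measurable_consrow d (X : measurableType d) n (f : X -> R)
    (g : X -> borelRow n) :
  measurable_fun setT f -> measurable_fun setT g ->
  measurable_fun setT (fun x => consrow (f x) (g x) : borelRow n.+1).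
Proof.
move=> mf mg; apply: measurable_of_row_coord => i.
have [j ->|->] := unliftP ord0 i.
  by under eq_fun do rewrite consrowS; exact: measurable_row_coord.
by under eq_fun do rewrite consrow0.
Qed.


(** * Integrals depending on a parameter *)

Local Open Scope ereal_scope.
Notation leb := (@lebesgue_measure R).

(** The integral is the difference of those of the positive and negative parts, each measurable in
    [x] by Tonelli; this covers functions of any sign, integrable or not. *)
Lemma measurable_parameter_integral d d' (X : measurableType d) (Y : measurableType d')
    (m : {sigma_finite_measure set Y -> \bar R}) (h : X * Y -> \bar R) :
  measurable_fun setT h -> measurable_fun setT (fun x => \int[m]_y h (x, y)).
Proof.
move=> mh; rewrite (_ : (fun x => _) = fubini_F m h^\+ \- fubini_F m h^\-).
  apply: emeasurable_funB; apply: measurable_fun_fubini_tonelli_F => //.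
    exact: measurable_funepos.
  exact: measurable_funeneg.
apply/funext => x; rewrite integralE /fubini_F.
by congr (_ - _); apply: eq_integral => y _; rewrite ?(funeposE, funenegE).
Qed.

(** Induction on [n] with [X] generalised: the outermost coordinate joins the parameter, so the
    induction hypothesis is used on [X * R]. *)
Lemma measurable_parameter_iint n d (X : measurableType d)
    (h : X * borelRow n -> \bar R) :
  measurable_fun setT h -> measurable_fun setT (fun x => iint (fun v => h (x, v))).
Proof.
elim: n d X h => [|n IHn] d X h mh /=.
  by apply: (measurableT_comp mh); exact: measurable_fun_pair.
pose k (z : (X * measurableTypeR R) * borelRow n) := h (z.1.1, consrow z.1.2 z.2).
have mk : measurable_fun setT k.
  apply: (measurableT_comp mh); apply: measurable_fun_pair.
    exact: measurableT_comp.
  by apply: measurable_consrow => //; exact: measurableT_comp.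
exact: (measurable_parameter_integral leb (IHn _ _ k mk)).
Qed.

Lemma measurable_iint_consrow n (f : borelRow n.+1 -> \bar R) :
  measurable_fun setT f ->
  measurable_fun (setT : set (measurableTypeR R))
    (fun t => iint (fun v : 'rV[R]_n => f (consrow t v))).
Proof.
move=> mf; apply: (@measurable_parameter_iint n _ (measurableTypeR R)
  (fun z => f (consrow z.1 z.2))).
by apply: (measurableT_comp mf); exact: measurable_consrow.
Qed.

(** * Monotonicity and linearity of the iterated integral *)

Lemma eq_iint n (f g : 'rV[R]_n -> \bar R) : f =1 g -> iint f = iint g.
Proof. by move=> /funext ->. Qed.

Lemma iint_ge0 n (f : 'rV[R]_n -> \bar R) : (forall v, 0 <= f v) -> 0 <= iint f.
Proof.
elim: n f => [|n IHn] f f0 /=; first exact: f0.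
by apply: integral_ge0 => t _; apply: IHn => v; exact: f0.
Qed.

Lemma measurable_consrow_section n (f : borelRow n.+1 -> \bar R) t :
  measurable_fun setT f ->
  measurable_fun (setT : set (borelRow n)) (fun v => f (consrow t v)).
Proof. by move=> mf; apply: (measurableT_comp mf); exact: measurable_consrow. Qed.

Lemma le_iint n (f g : borelRow n -> \bar R) :
  measurable_fun setT f -> measurable_fun setT g ->
  (forall v, 0 <= f v) -> (forall v, f v <= g v) -> iint f <= iint g.
Proof.
elim: n f g => [|n IHn] f g mf mg f0 fg /=; first exact: fg.
apply: ge0_le_integral => //.
- by move=> t _; exact: iint_ge0.
- exact: measurable_iint_consrow.
- exact: measurable_iint_consrow.
- by move=> t _; apply: IHn => //; exact: measurable_consrow_section.
Qed.

(** Valid even at [oo - oo]: its conventional value is infinite and is fixed by multiplication by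
    [c > 0]. This lets scalars leave integrals of arbitrary measurable functions. *)
Lemma muleBr_EFin (c : R) (x y : \bar R) : (0 < c)%R ->
  c%:E * (x - y) = c%:E * x - c%:E * y.
Proof.
move=> c0; have cE : (0 < c%:E)%E by rewrite lte_fin.
case: x y => [x| |] [y| |] //=; rewrite ?(gt0_muley cE, gt0_muleNy cE)//.
by rewrite -EFinB -!EFinM -EFinB mulrBr.
Qed.

Lemma integralZl_measurable d (X : measurableType d)
    (m : {measure set X -> \bar R}) (f : X -> \bar R) (c : R) : (0 <= c)%R ->
  measurable_fun setT f -> \int[m]_x (c%:E * f x) = c%:E * \int[m]_x f x.
Proof.
rewrite le_eqVlt => /predU1P[<- _|c0 mf].
  by under eq_integral do rewrite mul0e; rewrite integral0 mul0e.
rewrite integralE ge0_funeposM ?ge0_funenegM ?ltW//.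
rewrite (ge0_integralZl_EFin _ _ _ (measurable_funepos _)) ?ltW//.
rewrite (ge0_integralZl_EFin _ _ _ (measurable_funeneg _)) ?ltW//.
by rewrite -muleBr_EFin// [in RHS]integralE.
Qed.

Lemma iintZl n (f : borelRow n -> \bar R) (c : R) : (0 <= c)%R ->
  measurable_fun setT f -> iint (fun v => c%:E * f v) = c%:E * iint f.
Proof.
move=> c0; elim: n f => [//|n IHn] f mf /=.
rewrite -integralZl_measurable//; last exact: measurable_iint_consrow.
apply: eq_integral => t _.
by rewrite (IHn (fun v => f (consrow t v)))//; exact: measurable_consrow_section.
Qed.

Lemma iintN n (f : 'rV[R]_n -> \bar R) : (forall v, 0 <= f v) ->
  iint (fun v => - f v) = - iint f.
Proof.
elim: n f => [//|n IHn] f f0 /=.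
rewrite -integral_ge0N; last by move=> t _; exact: iint_ge0.
by apply: eq_integral => t _; rewrite IHn.
Qed.

Lemma iintD n (f g : borelRow n -> \bar R) :
  measurable_fun setT f -> measurable_fun setT g ->
  (forall v, 0 <= f v) -> (forall v, 0 <= g v) ->
  iint (fun v => f v + g v) = iint f + iint g.
Proof.
elim: n f g => [//|n IHn] f g mf mg f0 g0 /=.
rewrite -ge0_integralD//; last 4 first.
- by move=> t _; exact: iint_ge0.
- exact: measurable_iint_consrow.
- by move=> t _; exact: iint_ge0.
- exact: measurable_iint_consrow.
apply: eq_integral => t _.
by rewrite (IHn (fun v => f (consrow t v)) (fun v => g (consrow t v)))//;
  exact: measurable_consrow_section.
Qed.

(** * Tonelli for iterated integrals *)

Lemma integral_iint n d (X : measurableType d)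
    (m : {sigma_finite_measure set X -> \bar R}) (h : X * borelRow n -> \bar R) :
  measurable_fun setT h -> (forall z, 0 <= h z) ->
  \int[m]_x iint (fun v => h (x, v)) = iint (fun v => \int[m]_x h (x, v)).
Proof.
elim: n d X m h => [//|n IHn] d X m h mh h0 /=.
have mk : measurable_fun setT
    (fun z : (X * measurableTypeR R) * borelRow n => h (z.1.1, consrow z.1.2 z.2)).
  apply: (measurableT_comp mh); apply: measurable_fun_pair.
    exact: measurableT_comp.
  by apply: measurable_consrow => //; exact: measurableT_comp.
(* Tonelli exchanges [m] with the outermost coordinate; at fixed [t] the induction hypothesis moves
   [m] past the remaining ones. *)
rewrite (fubini_tonelli (m1 := m) (m2 := leb)
  (fun z => iint (fun v => h (z.1, consrow z.2 v)))) /=; last 2 first.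
- exact: measurable_parameter_iint mk.
- by move=> z; exact: iint_ge0.
apply: eq_integral => t _.
apply: (IHn _ X m (fun z => h (z.1, consrow t z.2))) => //.
apply: (measurableT_comp mh); apply: measurable_fun_pair => //.
exact: measurable_consrow.
Qed.

(** Induction on [n]: at a fixed first coordinate of [u] the induction hypothesis exchanges the
    rest, then [integral_iint] carries the integral over that coordinate inside. *)
Lemma iint_tonelli n m (h : borelRow n * borelRow m -> \bar R) :
  measurable_fun setT h -> (forall z, 0 <= h z) ->
  iint (fun u => iint (fun v => h (u, v))) = iint (fun v => iint (fun u => h (u, v))).
Proof.
elim: n h => [//|n IHn] h mh h0 /=.
under eq_integral => t _.
  rewrite (IHn (fun z => h (consrow t z.1, z.2)))//; last first.
    apply: (measurableT_comp mh); apply: measurable_fun_pair => //.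
    exact: measurable_consrow.
  over.
rewrite (integral_iint leb
  (h := fun z => iint (fun u => h (consrow z.1 u, z.2))))//.
  apply: (measurable_parameter_iint (n := n) (X := (measurableTypeR R * borelRow m)%type)
    (h := fun z => h (consrow z.1.1 z.2, z.1.2))).
  apply: (measurableT_comp mh); apply: measurable_fun_pair.
    by apply: measurable_consrow => //; exact: measurableT_comp.
  exact: measurableT_comp.
by move=> z; exact: iint_ge0.
Qed.

(** * Affine changes of variable *)

Lemma measurable_affine (c b : R) :
  measurable_fun (setT : set (measurableTypeR R))
    (fun t : R => (c * t + b)%R : measurableTypeR R).
Proof. by apply: measurable_funD => //; exact: measurable_funM. Qed.

(** By uniqueness of Lebesgue measure: [c] times its image under [t -> c t + b] gives each interval
    []x, y]] its length. *)
Lemma lebesgue_measure_affine (c b : R) (A : set (measurableTypeR R)) :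
  (0 < c)%R -> measurable A ->
  leb A = c%:E * leb ((fun t : R => (c * t + b)%R) @^-1` A).
Proof.
move=> c0 mA.
pose phi (t : measurableTypeR R) : measurableTypeR R := (c * t + b)%R.
have mphi : measurable_fun setT phi by exact: measurable_affine.
pose nu : {measure set (measurableTypeR R) -> \bar R} :=
  mscale (NngNum (ltW c0)) (pushforward leb phi).
rewrite (@lebesgue_measure_unique R (nu mphi))// => _ [[x y] _ <-] /=.
rewrite /mscale /= /pushforward /=.
rewrite (_ : phi @^-1` _ = `]((x - b) / c)%R, ((y - b) / c)%R]%classic); last first.
  apply/seteqP; split=> t /=; rewrite !in_itv/= /phi.
    by rewrite ltr_pdivrMr// ler_pdivlMr// ltrBlDr lerBrDr mulrC.
  by rewrite ltr_pdivrMr// ler_pdivlMr// ltrBlDr lerBrDr mulrC.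
rewrite !lebesgue_measure_itv/= !lte_fin ltr_pM2r ?invr_gt0// ltrD2r.
case: ifPn => _; last by rewrite mule0.
rewrite -!EFinB -EFinM; congr EFin.
by rewrite -mulrBl mulrCA mulfV ?gt_eqF// mulr1 opprB addrA subrK.
Qed.

Lemma ge0_integral_affine (c b : R) (f : R -> \bar R) : (0 < c)%R ->
  measurable_fun setT f -> (forall t, 0 <= f t) ->
  \int[leb]_t f (c * t + b)%R = c^-1%:E * \int[leb]_t f t.
Proof.
move=> c0 mf f0.
pose phi (t : measurableTypeR R) : measurableTypeR R := (c * t + b)%R.
have mphi : measurable_fun setT phi by exact: measurable_affine.
pose nu : {measure set (measurableTypeR R) -> \bar R} :=
  mscale (NngNum (ltW c0)) (pushforward leb phi).
have -> : \int[leb]_t f t = \int[nu mphi]_t f t.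
  apply: eq_measure_integral => A mA _.
  exact: (lebesgue_measure_affine b c0 mA).
rewrite ge0_integral_mscale// muleA -EFinM mulVf ?gt_eqF// mul1e.
by rewrite ge0_integral_pushforward.
Qed.

Lemma integral_affine (c b : R) (f : R -> \bar R) : (0 < c)%R ->
  measurable_fun setT f ->
  \int[leb]_t f (c * t + b)%R = c^-1%:E * \int[leb]_t f t.
Proof.
move=> c0 mf; rewrite integralE [in RHS]integralE [RHS]muleBr_EFin ?invr_gt0//.
rewrite -!(@ge0_integral_affine _ b)//; last 2 first.
- exact: measurable_funeneg.
- exact: measurable_funepos.
by congr (_ - _); apply: eq_integral => t _; rewrite ?(funeposE, funenegE).
Qed.

Lemma scale1_consrow n c t (v : 'rV[R]_n) :
  scale1 c (consrow t v) = consrow (c * t)%R v.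
Proof.
apply/rowP => i; rewrite mxE; have [j ->|->] := unliftP ord0 i.
  by rewrite !consrowS.
by rewrite !consrow0 eqxx.
Qed.

(** [scale1] touches only the coordinate integrated outermost, so a one-dimensional substitution
    suffices. *)
Lemma iint_scale1 n (c : R) (f : borelRow n.+1 -> \bar R) : (0 < c)%R ->
  measurable_fun setT f ->
  iint (fun u => f (scale1 c u)) = c^-1%:E * iint f.
Proof.
move=> c0 mf /=; rewrite -(@integral_affine _ 0%R)//; last exact: measurable_iint_consrow.
apply: eq_integral => t _; rewrite addr0.
by apply: eq_iint => v; rewrite -/(consrow t v) scale1_consrow.
Qed.

(** * Strict positivity of integrals *)

Lemma integral_gt0 d (X : measurableType d) (m : {measure set X -> \bar R})
    (A : set X) (f : X -> \bar R) : measurable A -> 0 < m A ->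
  measurable_fun A f -> (forall x, 0 < f x) -> 0 < \int[m]_(x in A) f x.
Proof.
move=> mA A0 mf f0; rewrite lt0e integral_ge0 ?andbT; last by move=> x _; exact: ltW.
apply/negP => /eqP f00.
(* A zero integral would make [f] vanish almost everywhere on [A], so [A] would be null. *)
have : ae_eq m A f (cst 0).
  apply/ae_eq_integral_abs => //; rewrite -[RHS]f00.
  by apply: eq_integral => x _; rewrite gee0_abs// ltW.
move=> [N [mN N0 AN]].
suff : m A <= 0 by rewrite leNgt A0.
rewrite -N0; apply: le_measure; rewrite ?inE// => x Ax; apply: AN => /= /(_ Ax) fx0.
by have := f0 x; rewrite fx0 ltxx.
Qed.

Lemma iint_gt0 n (f : borelRow n -> \bar R) : measurable_fun setT f ->
  (forall v, 0 < f v) -> 0 < iint f.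
Proof.
elim: n f => [|n IHn] f mf f0 /=; first exact: f0.
apply: integral_gt0 => //.
- have := lebesgue_measure_itv (Interval -oo%O +oo%O : interval R).
  by rewrite set_itvE/= => ->; rewrite addye// lt0y.
- exact: measurable_iint_consrow.
- by move=> t; apply: IHn => //; exact: measurable_consrow_section.
Qed.
End borel_row.

(** * The Dirichlet form of the rescaled Barker kernel *)

Section barker.
Variable R : realType.
Local Notation borelRow n := (g_sigma_algebraType [set U : set 'rV[R]_n | open U]).

(** * Directional derivatives and the rescaling of the first coordinate *)

Lemma dnbhs0_scale (c : R) : c != 0 -> (fun h => c * h) @ 0^' --> (0 : R)^'.
Proof.
move=> c0 A /nbhs_ballP[e /= e0 eA]; apply/nbhs_ballP.
have cgt0 : 0 < `|c| by rewrite normr_gt0.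
exists (e / `|c|) => /=; first by rewrite divr_gt0.
move=> h; rewrite -ball_normE /ball_/= sub0r normrN => he h0.
apply: eA; last by rewrite mulf_neq0.
by rewrite -ball_normE /ball_/= sub0r normrN normrM mulrC -ltr_pdivlMr.
Qed.

(** A chain rule along a single line, from derivability in that direction alone: the difference
    quotient of [g] at [h] is [c] times that of [f] at [c * h]. *)
Lemma derive_cst_comp_affine n (f g : 'rV[R]_n -> R) (x y v : 'rV[R]_n) (k c : R) :
  c != 0 -> derivable f y v ->
  (forall h, g (h *: v + x) = k + f ((c * h) *: v + y)) ->
  derive g x v = c * derive f y v.
Proof.
move=> c0 fyv gf; apply: cvg_lim => //=.
have gx : g x = k + f y by have := gf 0; rewrite mulr0 !scale0r !add0r.
rewrite (_ : (fun h => _) =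
    (fun h => c *: ((c * h)^-1 *: ((f \o shift y) ((c * h) *: v) - f y)))); last first.
  apply/funext => h /=; rewrite gf gx opprD addrACA subrr add0r.
  by rewrite scalerA invfM mulrA mulfV// mul1r.
apply: cvgZr.
apply: (@cvg_comp _ _ _ (fun h => c * h)
  (fun h => h^-1 *: ((f \o shift y) (h *: v) - f y)) _ 0^') => //.
exact: dnbhs0_scale.
Qed.

Lemma scale1K n (c : R) (x : 'rV[R]_n.+1) : c != 0 -> scale1 c (scale1 c^-1 x) = x.
Proof.
by move=> c0; apply/rowP => i; rewrite !mxE; case: eqP => //; rewrite mulVKf.
Qed.

Lemma scale1KV n (c : R) (x : 'rV[R]_n.+1) : c != 0 -> scale1 c^-1 (scale1 c x) = x.
Proof. by move=> c0; rewrite -{2}(invrK c) scale1K ?invr_neq0. Qed.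

Lemma scale11 n (x : 'rV[R]_n.+1) : scale1 1 x = x.
Proof. by apply/rowP => i; rewrite !mxE mul1r if_same. Qed.

Lemma pi_scaled1 n (p : 'rV[R]_n.+1 -> R) : pi_scaled p 1 = p.
Proof. by apply/funext => x; rewrite /pi_scaled invr1 scale11 mul1r. Qed.

Lemma measurable_scale1 n (c : R) :
  measurable_fun setT (scale1 c : borelRow n.+1 -> borelRow n.+1).
Proof.
apply: measurable_of_row_coord => i.
rewrite (_ : (fun x => _) = (fun x : borelRow n.+1 =>
  (if i == ord0 then c else 1) * (x : 'rV[R]_n.+1) 0 i)); last first.
  by apply/funext => x; rewrite mxE; case: ifP; rewrite ?mul1r.
by apply: measurable_funM => //; exact: measurable_coord.
Qed.

(** * The logistic factors of the Barker proposal *)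

Definition barker_weight n (p : 'rV[R]_n -> R) (u v : 'rV[R]_n) : R :=
  \prod_(i < n) (1 + expR (- (partial i (fun z => ln (p z)) u) * (v 0 i - u 0 i)))^-1.

Lemma barker_weight_gt0 n (p : 'rV[R]_n -> R) u v : 0 < barker_weight p u v.
Proof. by apply: prodr_gt0 => i _; rewrite invr_gt0 addr_gt0 ?expR_gt0. Qed.

Lemma barker_weight_le1 n (p : 'rV[R]_n -> R) u v : barker_weight p u v <= 1.
Proof.
rewrite -[leRHS](@big1 _ _ *%R _ (index_enum 'I_n) xpredT (fun=> 1))//.
apply: ler_prod => i _; rewrite invr_ge0 addr_ge0 ?expR_ge0//=.
by rewrite invf_le1 ?lerDl ?expR_ge0// addr_gt0 ?expR_gt0.
Qed.

Lemma barker_qE n mu0 sigma (p : 'rV[R]_n -> R) x y :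
  barker_q mu0 sigma p x y =
  (2 / sigma) ^+ n * prod_density mu0 (sigma^-1 *: (y - x)) * barker_weight p x y.
Proof.
rewrite /barker_q !big_split/= !prodr_const card_ord -exprMn; congr (_ * _ * _).
by apply: eq_bigr => i _; rewrite !mxE mulrC.
Qed.

Lemma prod_density_ge0 n (mu0 : R -> R) (x : 'rV[R]_n) :
  (forall t, 0 <= mu0 t) -> 0 <= prod_density mu0 x.
Proof. by move=> mu0_ge0; apply: prodr_ge0 => i _. Qed.

Lemma prod_densityN n (mu0 : R -> R) (x : 'rV[R]_n) :
  (forall t, mu0 (- t) = mu0 t) -> prod_density mu0 (- x) = prod_density mu0 x.
Proof. by move=> mu0N; apply: eq_bigr => i _; rewrite mxE mu0N. Qed.

(** The logarithms differ by the constant [ln l^-1], and a step [h] along the first axis from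
    [scale1 l u] is a step [h / l] from [u]. *)
Lemma partial_ln_pi_scaled n (p : 'rV[R]_n.+1 -> R) (l : R) i u : 0 < l ->
  (forall x, 0 < p x) -> (forall i x, derivable (fun x => ln (p x)) x (ebasis R i)) ->
  partial i (fun z => ln (pi_scaled p l z)) (scale1 l u) =
  (if i == ord0 then l^-1 else 1) * partial i (fun z => ln (p z)) u.
Proof.
move=> l0 p0 dp; apply: (@derive_cst_comp_affine _ _ _ _ _ _ (ln l^-1)) => //.
  by case: ifP => _; rewrite ?oner_neq0// invr_eq0 gt_eqF.
move=> h; rewrite /pi_scaled lnM ?posrE ?invr_gt0//; congr (_ + ln (p _)).
apply/rowP => j; rewrite !mxE eqxx/=.
have [->|ji] := eqVneq j i.
  by case: eqP => _; rewrite !mulr1 ?mul1r// mulrDr mulKf ?gt_eqF.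
by rewrite !mulr0 !add0r; case: eqP => _ //; rewrite mulKf ?gt_eqF.
Qed.

Lemma barker_weight_scaled n (p : 'rV[R]_n.+1 -> R) (l : R) u v : 0 < l ->
  (forall x, 0 < p x) -> (forall i x, derivable (fun x => ln (p x)) x (ebasis R i)) ->
  barker_weight (pi_scaled p l) (scale1 l u) (scale1 l v) = barker_weight p u v.
Proof.
move=> l0 p0 dp; apply: eq_bigr => i _; rewrite partial_ln_pi_scaled// !mxE.
congr ((1 + expR _)^-1); case: ifP => _; last by rewrite mul1r.
by rewrite -mulrBr -mulrN mulrACA mulVf ?gt_eqF// mul1r.
Qed.

Lemma scale1_rescaled_diff n (l s : R) (u v : 'rV[R]_n.+1) :
  s *: (scale1 l v - scale1 l u) = scale1 l (s *: (v - u)).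
Proof.
apply/rowP => i; rewrite !mxE; case: ifP => _ //.
by rewrite -mulrBr mulrCA.
Qed.

Lemma scale1_diffE n (l s : R) (u v : 'rV[R]_n.+1) i :
  scale1 l (s *: (v - u)) 0 i =
  (if i == ord0 then l else 1) * (s * (v 0 i - u 0 i)).
Proof. by rewrite !mxE; case: ifP; rewrite ?mul1r. Qed.

(** * The flow of accepted moves *)

Lemma mh_flowE n (p : 'rV[R]_n -> R) q x y : 0 < p x -> 0 <= q x y ->
  (q x y = 0 -> q y x = 0) ->
  p x * (q x y * mh_accept p q x y) = Num.min (p x * q x y) (p y * q y x).
Proof.
(* If [q x y = 0] the acceptance ratio has denominator zero, but both sides vanish because
   [q y x = 0] too; otherwise [p x * q x y] cancels. *)
move=> px; rewrite le_eqVlt => /predU1P[qxy0 /(_ (esym qxy0)) ->|qxy _].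
  by rewrite -qxy0 mul0r !mulr0 minxx.
have pq : 0 < p x * q x y by rewrite mulr_gt0.
by rewrite mulrA /mh_accept minr_pMr ?ltW// mulr1 [X in Num.min _ X]mulrC divfK ?gt_eqF.
Qed.

(** The flow density in the coordinates [u], [v], up to the factor [l^-1] of the density; [l] enters
    through [prod_density] only. *)
Definition barker_flow n (p : 'rV[R]_n.+1 -> R) (mu0 : R -> R) (sigma l : R)
    (u v : 'rV[R]_n.+1) : R :=
  (2 / sigma) ^+ n.+1 * prod_density mu0 (scale1 l (sigma^-1 *: (v - u))) *
  Num.min (p u * barker_weight p u v) (p v * barker_weight p v u).

Section fixed.
Variables (n : nat) (p : 'rV[R]_n.+1 -> R) (mu0 : R -> R) (sigma : R).
Hypothesis pB : borel_fun p.
Hypothesis p_gt0 : forall x, 0 < p x.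
Hypothesis lnp_C1 : C1 (fun x => ln (p x)).
Hypothesis mmu0 : measurable_fun setT mu0.
Hypothesis mu0_ge0 : forall t, 0 <= mu0 t.
Hypothesis mu0N : forall t, mu0 (- t) = mu0 t.
Hypothesis sigma_gt0 : 0 < sigma.

Let sigma_fac : 0 < (2 / sigma) ^+ n.+1.
Proof. by rewrite exprn_gt0 ?divr_gt0. Qed.

Lemma barker_flow_ge0 (l : R) u v : 0 <= barker_flow p mu0 sigma l u v.
Proof.
rewrite /barker_flow mulr_ge0//; first by rewrite mulr_ge0 ?prod_density_ge0 ?ltW.
by rewrite le_min !mulr_ge0// ltW// barker_weight_gt0.
Qed.

Lemma barker_flowE (l : R) u v : 0 < l ->
  let P := pi_scaled p l in let Q := barker_q mu0 sigma P in
  P (scale1 l u) * (Q (scale1 l u) (scale1 l v) *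
    mh_accept P Q (scale1 l u) (scale1 l v)) = l^-1 * barker_flow p mu0 sigma l u v.
Proof.
move=> l0 P Q; have dp := lnp_C1.1.
have PE z : P (scale1 l z) = l^-1 * p z by rewrite /P /pi_scaled scale1KV ?gt_eqF.
set K := (2 / sigma) ^+ n.+1 * prod_density mu0 (scale1 l (sigma^-1 *: (v - u))).
have K0 : 0 <= K by rewrite /K mulr_ge0 ?prod_density_ge0// ltW.
have Quv : Q (scale1 l u) (scale1 l v) = K * barker_weight p u v.
  by rewrite /Q barker_qE barker_weight_scaled// scale1_rescaled_diff.
(* Evenness of [mu0] gives the reverse proposal the same factor [K], which can then leave the
   minimum. *)
have Qvu : Q (scale1 l v) (scale1 l u) = K * barker_weight p v u.
  rewrite /Q barker_qE barker_weight_scaled// scale1_rescaled_diff.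
  congr (_ * _ * _); rewrite -prod_densityN//; congr prod_density.
  by apply/rowP => i; rewrite !mxE; case: ifP => _; rewrite -!mulrN opprB.
rewrite mh_flowE; last 3 first.
- by rewrite PE mulr_gt0 ?invr_gt0.
- by rewrite Quv mulr_ge0// ltW// barker_weight_gt0.
(* As [barker_weight] never vanishes, a zero proposal means [K = 0], hence a zero reverse
   proposal. *)
- move/eqP; rewrite Quv Qvu mulf_eq0 (gt_eqF (barker_weight_gt0 _ _ _)) orbF.
  by move=> /eqP ->; rewrite mul0r.
rewrite !PE Quv Qvu /barker_flow -/K; clearbody K.
rewrite !minr_pMr ?invr_ge0 ?(ltW l0)//.
by congr (Order.min _ _); rewrite -!mulrA; congr (_ * _); exact: mulrCA.
Qed.

(** * Measurability of the flow *)

Lemma measurable_barker_weight :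
  measurable_fun setT (fun z : borelRow n.+1 * borelRow n.+1 => barker_weight p z.1 z.2).
Proof.
apply: measurable_prod => i _.
apply: (@measurableT_comp _ _ _ _ _ _ (fun t : R => (1 + expR t)^-1)).
  (* The logistic factor is measurable because it is monotone. *)
  apply: nonincreasing_measurable => // s t st.
  by rewrite lef_pV2 ?posrE ?addr_gt0 ?expR_gt0// lerD2l ler_expR.
apply: measurable_funM.
  apply: measurable_funN; apply: (measurableT_comp (continuous_borel (lnp_C1.2 i))).
  exact: measurable_fst.
apply: measurable_funB; apply: measurable_row_coord.
  exact: measurable_snd.
exact: measurable_fst.
Qed.

Lemma measurable_prod_density_diff (l : R) s : measurable_fun setT
  (fun z : borelRow n.+1 * borelRow n.+1 => prod_density mu0 (scale1 l (s *: (z.2 - z.1)))).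
Proof.
apply: measurable_prod => i _; apply: (measurableT_comp mmu0).
apply: (@measurable_row_coord _ _ _ _ i (fun z : borelRow n.+1 * borelRow n.+1 =>
   scale1 l (s *: (z.2 - z.1)) : borelRow n.+1)).
apply: (measurableT_comp (measurable_scale1 l)); apply: measurable_of_row_coord => j.
rewrite (_ : (fun x => _) = (fun x : borelRow n.+1 * borelRow n.+1 =>
   s * ((x.2 : 'rV[R]_n.+1) 0 j - (x.1 : 'rV[R]_n.+1) 0 j))).
  apply: measurable_funM => //; apply: measurable_funB; apply: measurable_row_coord.
    exact: measurable_snd.
  exact: measurable_fst.
by apply/funext => x; rewrite !mxE.
Qed.

Lemma measurable_barker_flow (l : R) : measurable_fun setT
  (fun z : borelRow n.+1 * borelRow n.+1 => barker_flow p mu0 sigma l z.1 z.2).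
Proof.
have mp : measurable_fun (setT : set (borelRow n.+1)) p by exact/borel_funP.
apply: measurable_funM.
  by apply: measurable_funM => //; exact: measurable_prod_density_diff.
apply: measurable_minr; apply: measurable_funM.
- by apply: (measurableT_comp mp); exact: measurable_fst.
- exact: measurable_barker_weight.
- by apply: (measurableT_comp mp); exact: measurable_snd.
- apply: (measurableT_comp measurable_barker_weight
    (g := fun z : borelRow n.+1 * borelRow n.+1 => (z.2, z.1))).
  by apply: measurable_fun_pair; [exact: measurable_snd|exact: measurable_fst].
Qed.

(** * The Dirichlet form and its test functions in rescaled coordinates *)

Definition barker_form (l : R) (g : 'rV[R]_n.+1 -> R) : \bar R :=
  iint (fun u => iint (fun v => ((g v - g u) ^+ 2 * barker_flow p mu0 sigma l u v)%:E)).

Lemma measurable_barker_form (l : R) (g : borelRow n.+1 -> R) : measurable_fun setT g ->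
  measurable_fun setT (fun z : borelRow n.+1 * borelRow n.+1 =>
    ((g z.2 - g z.1) ^+ 2 * barker_flow p mu0 sigma l z.1 z.2)%:E).
Proof.
move=> mg; apply/measurable_EFinP; apply: measurable_funM; last exact: measurable_barker_flow.
apply: measurable_funX; apply: measurable_funB; apply: (measurableT_comp mg).
  exact: measurable_snd.
exact: measurable_fst.
Qed.

(** The substitutions in [x] and in [y] contribute a Jacobian [l] each and the flow contributes
    [l^-1], which leaves one factor [l]. *)
Lemma dirichlet_barkerE (l : R) (f : borelRow n.+1 -> R) : 0 < l -> measurable_fun setT f ->
  dirichlet (pi_scaled p l) (barker_q mu0 sigma (pi_scaled p l)) f =
  ((2^-1 * l)%:E * barker_form l (fun u => f (scale1 l u)))%E.
Proof.
move=> l0 mf; rewrite /dirichlet EFinM -muleA; congr (_ * _)%E.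
set g := fun u => f (scale1 l u).
have mg : measurable_fun (setT : set (borelRow n.+1)) g.
  exact: (measurableT_comp mf (measurable_scale1 l)).
have mk := measurable_barker_form l mg.
have mkv (u : borelRow n.+1) : measurable_fun (setT : set (borelRow n.+1))
    (fun v => ((g v - g u) ^+ 2 * barker_flow p mu0 sigma l u v)%:E).
  exact: (measurableT_comp mk (pair1_measurable u)).
set P := pi_scaled p l; set Q := barker_q mu0 sigma P.
have PE z : P (scale1 l z) = l^-1 * p z by rewrite /P /pi_scaled scale1KV ?gt_eqF.
have li : 0 < l^-1 by rewrite invr_gt0.
have inner u : ((P (scale1 l u))%:E *
    mh_int P Q (scale1 l u) (fun y => ((f y - f (scale1 l u)) ^+ 2)%:E))%E =
    iint (fun v => ((g v - g u) ^+ 2 * barker_flow p mu0 sigma l u v)%:E).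
  have Pu : 0 < P (scale1 l u) by rewrite PE mulr_gt0.
  (* Rejected moves contribute nothing: the increment of [f] is zero there. *)
  rewrite /mh_int subrr expr0n mule0 adde0.
  (* The integrand over [y] is written as [k] at [scale1 l^-1 y]; dividing by [P (scale1 l u)]
     undoes the prefactor that turns the kernel into the flow. *)
  pose k (v : borelRow n.+1) := (((P (scale1 l u))^-1 * l^-1)%:E *
    ((g v - g u) ^+ 2 * barker_flow p mu0 sigma l u v)%:E)%E.
  rewrite (_ : (fun y => _) = (fun y => k (scale1 l^-1 y))); last first.
    apply/funext => y /=.
    rewrite /k -{1 2 3}(scale1K y (lt0r_neq0 l0)); set v := scale1 l^-1 y.
    rewrite -!EFinM -/(g v) -/(g u); congr EFin.
    rewrite -(mulKf (lt0r_neq0 Pu) (_ * mh_accept _ _ _ _)) barker_flowE//.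
    by rewrite [_^-1 * (_ * _)]mulrA mulrCA.
  rewrite (@iint_scale1 _ _ _ k li); last by apply: measurable_funeM.
  rewrite iintZl ?mulr_ge0 ?invr_ge0 ?ltW// invrK !muleA -!EFinM.
  by rewrite mulrACA !mulfV ?gt_eqF// mul1r mul1e.
pose k (u : borelRow n.+1) :=
  iint (fun v => ((g v - g u) ^+ 2 * barker_flow p mu0 sigma l u v)%:E).
rewrite (_ : (fun x => _) = (fun x => k (scale1 l^-1 x))); last first.
  by apply/funext => x /=; rewrite /k -inner scale1K ?gt_eqF.
by rewrite (@iint_scale1 _ _ _ k li) ?invrK//; exact: measurable_parameter_iint mk.
Qed.

(** The Jacobian cancels the factor [l^-1] of the density. Valid for every Borel [f], so the
    conditions in [L2_01] transfer directly. *)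
Lemma expect_pi_scaled (l : R) (f : borelRow n.+1 -> R) : 0 < l -> measurable_fun setT f ->
  expect (pi_scaled p l) f = expect p (fun u => f (scale1 l u)).
Proof.
move=> l0 mf; have mg := measurableT_comp mf (measurable_scale1 l).
have mp : measurable_fun (setT : set (borelRow n.+1)) p by exact/borel_funP.
have li : 0 < l^-1 by rewrite invr_gt0.
have mh : measurable_fun (setT : set (borelRow n.+1)) (fun u => (p u * f (scale1 l u))%:E).
  by apply/measurable_EFinP; exact: measurable_funM.
pose k (u : borelRow n.+1) := ((l^-1)%:E * (p u * f (scale1 l u))%:E)%E.
rewrite /expect (_ : (fun x => _) = (fun x => k (scale1 l^-1 x))); last first.
  by apply/funext => x /=; rewrite /k scale1K ?gt_eqF// /pi_scaled -EFinM mulrA.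
rewrite (@iint_scale1 _ _ _ k li); last exact: measurable_funeM.
by rewrite iintZl ?ltW// muleA -EFinM mulVf ?gt_eqF// mul1e.
Qed.

Lemma variance_expect m (r : 'rV[R]_m -> R) f :
  Defs.variance r f = expect r (fun x => (f x - fine (expect r f)) ^+ 2).
Proof. by []. Qed.

Lemma variance_pi_scaled (l : R) (f : borelRow n.+1 -> R) : 0 < l -> measurable_fun setT f ->
  Defs.variance (pi_scaled p l) f = Defs.variance p (fun u => f (scale1 l u)).
Proof.
move=> l0 mf; rewrite !variance_expect (expect_pi_scaled l0 mf); set e := fine _.
rewrite (@expect_pi_scaled l (fun x => (f x - e) ^+ 2) l0)//.
by apply: measurable_funX; exact: measurable_funB.
Qed.

(** Serves the lower bound, which needs a test function for [p] from each one for the scaled target;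
    [L2_01_unscale] serves the upper bound. *)
Lemma L2_01_pi_scaled (l : R) f : 0 < l ->
  L2_01 (pi_scaled p l) f -> L2_01 p (fun u => f (scale1 l u)).
Proof.
move=> l0 [/borel_funP mf [Ef Vf]]; split.
  by apply/borel_funP; exact: (measurableT_comp mf (measurable_scale1 l)).
by rewrite -(expect_pi_scaled l0 mf) -(variance_pi_scaled l0 mf).
Qed.

Lemma L2_01_unscale (l : R) g : 0 < l ->
  L2_01 p g -> L2_01 (pi_scaled p l) (fun u => g (scale1 l^-1 u)).
Proof.
move=> l0 [/borel_funP mg [Eg Vg]].
have mf := measurableT_comp mg (measurable_scale1 l^-1).
have gE : g = (fun u => g (scale1 l^-1 (scale1 l u))).
  by apply/funext => u; rewrite scale1KV ?gt_eqF.
split; first exact/borel_funP.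
by rewrite (expect_pi_scaled l0 mf) (variance_pi_scaled l0 mf) -gE.
Qed.

End fixed.
End barker.

(** * Test functions and gap bounds *)

Section bounds.
Variable R : realType.
Local Notation borelRow n := (g_sigma_algebraType [set U : set 'rV[R]_n | open U]).
Local Notation leb := (@lebesgue_measure R).

(** * Product integrands and first marginals *)

Lemma iint_prod n (F : 'I_n -> R -> R) (c : R) : (forall i t, 0 <= F i t) ->
  (forall i, measurable_fun setT (F i)) ->
  (forall i, (\int[leb]_t (F i t)%:E = c%:E)%E) ->
  iint (fun w : 'rV[R]_n => (\prod_(i < n) F i (w 0 i))%:E) = (c ^+ n)%:E.
Proof.
elim: n F => [|n IHn] F F0 mF Fc /=; first by rewrite big_ord0.
(* The factor of the outermost coordinate is constant for the inner integral. *)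
have step t : iint (fun w : 'rV[R]_n =>
    (\prod_(i < n.+1) F i (consrow t w 0 i))%:E) = ((F ord0 t)%:E * (c ^+ n)%:E)%E.
  rewrite -(IHn (fun i => F (lift ord0 i)))// -iintZl//.
    apply: eq_iint => w; rewrite big_ord_recl consrow0 -EFinM; congr (EFin (_ * _)).
    by apply: eq_bigr => i _; rewrite consrowS.
  apply/measurable_EFinP; apply: measurable_prod => i _.
  by apply: (measurableT_comp (mF _)); exact: measurable_coord.
under eq_integral => t _ do rewrite step muleC.
have c0 : 0 <= c.
  by rewrite -lee_fin -(Fc ord0); apply: integral_ge0 => t _; rewrite lee_fin.
rewrite ge0_integralZl_EFin ?exprn_ge0//.
- by rewrite Fc -EFinM exprSr.
- by move=> t _; rewrite lee_fin.
- by apply/measurable_EFinP; exact: mF.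
Qed.

Lemma measurable_marginal n (p : borelRow n.+1 -> R) : measurable_fun setT p ->
  measurable_fun (setT : set (measurableTypeR R)) (marginal1 p).
Proof.
by move=> mp; apply: (@measurable_iint_consrow _ _ (EFin \o p)); exact/measurable_EFinP.
Qed.

Lemma marginal1_ge0 n (p : 'rV[R]_n.+1 -> R) t : (forall x, 0 <= p x) ->
  (0 <= marginal1 p t)%E.
Proof. by move=> p0; apply: iint_ge0 => v; rewrite lee_fin. Qed.

(** Scalars of either sign, for the negative value of the test function. *)
Lemma ge0_iintZl n (f : borelRow n -> \bar R) (c : R) :
  measurable_fun setT f -> (forall v, 0 <= f v)%E ->
  iint (fun v => c%:E * f v)%E = (c%:E * iint f)%E.
Proof.
move=> mf f0; have [c0|c0] := leP 0 c; first exact: iintZl.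
have c0' : 0 <= - c by rewrite oppr_ge0 ltW.
rewrite -[c]opprK EFinN mulNe -iintZl// -iintN; last first.
  by move=> v; rewrite mule_ge0// lee_fin.
by apply: eq_iint => v; rewrite mulNe.
Qed.

(** * Two-valued functions of the first coordinate *)

Lemma measurable_two_valued d (X : measurableType d) (A : set X) (a b : R) :
  measurable A -> measurable_fun setT (fun x => if x \in A then a else b).
Proof.
move=> mA; apply: measurable_fun_ifT => //.
apply: (measurable_fun_bool true); rewrite setTI (_ : _ @^-1` _ = A)//.
by apply/seteqP; split => x /=; [exact: set_mem|exact: mem_set].
Qed.

(** Integrating out the other coordinates leaves the marginal, whose integral is split over [A] and
    its complement. *)
Lemma expect_two_valued n (p : 'rV[R]_n.+1 -> R) (A : set R) (a b r1 r2 : R) :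
  borel_fun p -> (forall x, 0 <= p x) -> measurable A ->
  (\int[leb]_(t in A) marginal1 p t = r1%:E)%E ->
  (\int[leb]_(t in ~` A) marginal1 p t = r2%:E)%E ->
  expect p (fun u => if u 0 0 \in A then a else b) = (a * r1 + b * r2)%:E.
Proof.
move=> /borel_funP mp p0 mA p1 p2.
have mG := measurable_marginal mp.
have G0 t := marginal1_ge0 t p0.
have partE (B : set R) (r c : R) : measurable B ->
    (\int[leb]_(t in B) marginal1 p t = r%:E)%E ->
    (\int[leb]_(t in B) (c%:E * marginal1 p t) = (c * r)%:E)%E.
  move=> mB Br; rewrite integralZl// ?Br//; apply/integrableP; split.
    exact: measurable_funTS.
  by under eq_integral do rewrite gee0_abs//; rewrite Br ltry.
have step t : iint (fun v : 'rV[R]_n => (p (consrow t v) *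
    (if consrow t v 0 0 \in A then a else b))%:E) =
    ((if t \in A then a else b)%:E * marginal1 p t)%E.
  rewrite -ge0_iintZl.
  - by apply: eq_iint => v; rewrite consrow0 mulrC EFinM.
  - by apply: (@measurable_consrow_section _ _ (EFin \o p)); exact/measurable_EFinP.
  - by move=> v; rewrite lee_fin.
rewrite /expect/=; under eq_integral => t _ do rewrite step.
rewrite -(setUv A) integral_setU//.
- rewrite EFinD -(partE _ _ a mA p1) -(partE _ _ b (measurableC mA) p2).
  congr (_ + _)%E; apply: eq_integral => t; first by move=> ->.
  by rewrite in_setC => /negbTE ->.
- exact: measurableC.
- rewrite setUv; apply: emeasurable_funM => //; apply/measurable_EFinP.
  exact: measurable_two_valued.
- by rewrite disj_set2E setICr.
Qed.


(* The two values are [sqrt (r2 / r1)] and [- sqrt (r1 / r2)], where [r1] and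
   [r2 = 1 - r1] are the masses of the slab [0 <= x_1 <= 1] and its complement. *)
Lemma exists_slab_test_function n (p : 'rV[R]_n.+1 -> R) :
  prob_density p -> (forall x, 0 < p x) ->
  exists a b : R, L2_01 p (fun u => if u 0 0 \in `[0, 1]%classic then a else b).
Proof.
move=> [pB [p_ge0 pI]] p_gt0; pose A : set R := `[0, 1]%classic.
have mA : measurable A by exact: measurable_itv.
have mp := (borel_funP _).1 pB; have mG := measurable_marginal mp.
have G0 t : (0 < marginal1 p t)%E.
  apply: (@iint_gt0 _ _ (fun v => (p (consrow t v))%:E)) => [|v]; last by rewrite lte_fin.
  by apply: (@measurable_consrow_section _ _ (EFin \o p)); exact/measurable_EFinP.
set c1 := (\int[leb]_(t in A) marginal1 p t)%E.
set c2 := (\int[leb]_(t in ~` A) marginal1 p t)%E.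
have c1_gt0 : (0 < c1)%E.
  apply: integral_gt0 => //; last exact: measurable_funTS.
  have -> // : (0 < leb A)%E.
  by rewrite lebesgue_measure_itv/= lte_fin ltr01 -EFinB lte_fin subr0.
have c2_gt0 : (0 < c2)%E.
  apply: integral_gt0 => //; [exact: measurableC| |exact: measurable_funTS].
  (* []1, 2]] lies off the slab, so the complement is not null. *)
  apply: (@lt_le_trans _ _ (leb `]1, 2]%classic)).
    by rewrite lebesgue_measure_itv/= lte_fin ltr1n -EFinB lte_fin subr_gt0 ltr1n.
  apply: le_measure; rewrite ?inE//; first exact: measurableC.
  by move=> t /=; rewrite !in_itv/= => /andP[t1 _] /andP[_ /(lt_le_trans t1)]; rewrite ltxx.
have c12 : (c1 + c2 = 1)%E.
  rewrite /c1 /c2 -integral_setU//; last 3 first.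
  - exact: measurableC.
  - by rewrite setUv.
  - by rewrite disj_set2E setICr.
  by rewrite setUv -pI.
have c1_fin : c1 \is a fin_num.
  by rewrite ge0_fin_numE ?ltW// (@le_lt_trans _ _ 1%E) ?ltry// -c12 leeDl// ltW.
have c2_fin : c2 \is a fin_num.
  by rewrite ge0_fin_numE ?ltW// (@le_lt_trans _ _ 1%E) ?ltry// -c12 leeDr// ltW.
pose r1 := fine c1; pose r2 := fine c2.
have c1E : c1 = r1%:E by rewrite fineK.
have c2E : c2 = r2%:E by rewrite fineK.
have r1_gt0 : 0 < r1 by rewrite -lte_fin -c1E.
have r2_gt0 : 0 < r2 by rewrite -lte_fin -c2E.
have r12 : r1 + r2 = 1 by apply: EFin_inj; rewrite EFinD -c1E -c2E.
have twoE a b := expect_two_valued a b pB p_ge0 mA c1E c2E.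
pose a := Num.sqrt (r2 / r1); pose b := - Num.sqrt (r1 / r2).
have E0 : expect p (fun u => if u 0 0 \in A then a else b) = 0%E.
  (* Both [a * r1] and [- b * r2] equal the square root of [r1 * r2]. *)
  rewrite twoE; congr EFin; apply/eqP; rewrite mulNr subr_eq0; apply/eqP.
  rewrite /a -[X in _ * X = _](sqr_sqrtr (ltW r1_gt0)).
  rewrite -[X in _ = _ * X](sqr_sqrtr (ltW r2_gt0)).
  rewrite !sqrtrM ?ltW// !sqrtrV ?ltW// !expr2 !mulrA.
  by rewrite !mulfVK ?sqrtr_eq0 -?ltNge// mulrC.
exists a, b; split; last split => //.
  apply/borel_funP.
  apply: (@measurableT_comp _ _ _ _ _ _ (fun t : R => if t \in A then a else b)).
    exact: measurable_two_valued.
  exact: measurable_coord.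
(* With mean zero the variance is [a ^+ 2 * r1 + b ^+ 2 * r2 = r2 + r1 = 1]. *)
rewrite variance_expect E0/= (_ : (fun x => _) =
  (fun u : 'rV[R]_n.+1 => if u 0 0 \in A then a ^+ 2 else b ^+ 2)).
  rewrite twoE /a /b sqrrN !sqr_sqrtr ?divr_ge0 ?ltW//.
  by rewrite !divfK ?gt_eqF// addrC r12.
by apply/funext => u; rewrite subr0; case: ifP.
Qed.

End bounds.

(** * Lower and upper bounds linear in [l] *)

Section gap_bounds.
Variable R : realType.
Local Notation borelRow n := (g_sigma_algebraType [set U : set 'rV[R]_n | open U]).
Local Notation leb := (@lebesgue_measure R).

Variables (n : nat) (p : 'rV[R]_n.+1 -> R) (mu0 : R -> R) (sigma : R).
Hypothesis p_density : prob_density p.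
Hypothesis p_gt0 : forall x, 0 < p x.
Hypothesis lnp_C1 : C1 (fun x => ln (p x)).
Hypothesis mmu0 : measurable_fun setT mu0.
Hypothesis mu0_ge0 : forall t, 0 <= mu0 t.
Hypothesis mu0_int : (\int[leb]_t (mu0 t)%:E = 1)%E.
Hypothesis mu0N : forall t, mu0 (- t) = mu0 t.
Hypothesis sigma_gt0 : 0 < sigma.

Let pB : borel_fun p := p_density.1.
Let mp : measurable_fun (setT : set (borelRow n.+1)) p := (borel_funP p).1 pB.

Let dirichletE (l : R) (f : borelRow n.+1 -> R) (l0 : 0 < l) (mf : measurable_fun setT f) :=
  dirichlet_barkerE pB p_gt0 lnp_C1 mmu0 mu0_ge0 mu0N sigma_gt0 l0 mf.

(** Compared one test function at a time: the energy of [f] for [l] dominates [l] times the energy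
    of [g], its rescaling, for [1], since the flow at [l] dominates the flow at [1] pointwise. *)
Lemma barker_gap_lower (l : R) : 0 < l ->
  (forall x : 'rV[R]_n.+1, prod_density mu0 x <= prod_density mu0 (scale1 l x)) ->
  (l%:E * barker_gap p mu0 sigma 1 <= barker_gap p mu0 sigma l)%E.
Proof.
move=> l0 mono; apply: le_ereal_inf_tmp => _ [f fL2 <-].
have mf := (borel_funP _).1 fL2.1.
have gL2 := L2_01_pi_scaled pB l0 fL2.
set g := fun u => f (scale1 l u) in gL2 *.
have mg := (borel_funP _).1 gL2.1.
apply: (@le_trans _ _
    (l%:E * dirichlet (pi_scaled p 1) (barker_q mu0 sigma (pi_scaled p 1)) g)%E).
  rewrite lee_pmul2l ?lte_fin//; apply: ereal_inf_lbound.
  by exists g; rewrite ?pi_scaled1.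
rewrite (dirichletE l0 mf) (dirichletE ltr01 mg) muleA -EFinM mulr1 mulrC.
apply: lee_wpmul2l; first by rewrite lee_fin mulr_ge0// ltW.
rewrite (_ : (fun u => g (scale1 1 u)) = g); last by apply/funext => u; rewrite scale11.
apply: le_iint.
- exact: measurable_parameter_iint (measurable_barker_form _ _ _ _ _ mg).
- exact: measurable_parameter_iint (measurable_barker_form _ _ _ _ _ mg).
- by move=> u; apply: iint_ge0 => v; rewrite lee_fin mulr_ge0 ?sqr_ge0 ?barker_flow_ge0.
move=> u; apply: le_iint.
- exact: (measurableT_comp (measurable_barker_form _ _ _ _ _ mg)
    (pair1_measurable (u : borelRow n.+1))).
- exact: (measurableT_comp (measurable_barker_form _ _ _ _ _ mg)
    (pair1_measurable (u : borelRow n.+1))).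
- by move=> v; rewrite lee_fin mulr_ge0 ?sqr_ge0 ?barker_flow_ge0.
move=> v; rewrite lee_fin ler_wpM2l ?sqr_ge0// /barker_flow scale11.
apply: ler_wpM2r.
  by rewrite le_min !mulr_ge0// ltW// barker_weight_gt0.
by apply: ler_wpM2l => //; rewrite exprn_ge0// divr_ge0// ltW.
Qed.

(** * The flow through the slab *)

Lemma integral_mu0_affine (b : R) :
  (\int[leb]_t (mu0 (sigma^-1 * (t - b)))%:E = sigma%:E)%E.
Proof.
have := @integral_affine R sigma^-1 (- (sigma^-1 * b)) (EFin \o mu0).
rewrite invr_gt0 invrK /= mu0_int mule1 => <- //; last exact/measurable_EFinP.
by apply: eq_integral => t _; rewrite mulrBr.
Qed.

(** The first marginal of the product is [mu0] itself, as the other factors integrate to 1. *)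
Lemma mu0_bounded (M : R) :
  (forall t, (marginal1 (@prod_density R n.+1 mu0) t <= M%:E)%E) -> forall t, mu0 t <= M.
Proof.
move=> muM t; rewrite -lee_fin; apply: le_trans (muM t).
have prod1 := @iint_prod R n (fun=> mu0) 1 (fun=> mu0_ge0) (fun=> mmu0) (fun=> mu0_int).
rewrite -[leLHS]mule1 -[X in (_ * X%:E)%E](expr1n _ n) -prod1 -iintZl//.
  rewrite le_eqVlt; apply/orP; left; apply/eqP; apply: eq_iint => v.
  rewrite /prod_density big_ord_recl -/(consrow t v) consrow0 -EFinM.
  by congr (EFin (_ * _)); apply: eq_bigr => i _; rewrite consrowS.
apply/measurable_EFinP; apply: measurable_prod => i _.
by apply: (measurableT_comp mmu0); exact: measurable_coord.
Qed.

Let slab : set R := `[0, 1]%classic.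

Let proposal (l : R) (u v : 'rV[R]_n.+1) : R :=
  prod_density mu0 (scale1 l (sigma^-1 *: (v - u))).

(** The first factor is at most [M] on a slab of width 1, and each other coordinate integrates to
    [sigma]. Over the whole line the first factor would give [sigma / l] for [l > 0]; the slab makes
    the bound uniform in [l]. *)
Lemma slab_proposal_le (M l : R) (u : 'rV[R]_n.+1) : (forall t, mu0 t <= M) ->
  (iint (fun v : 'rV[R]_n.+1 => (\1_slab (v 0 0) * proposal l u v)%:E)
    <= (M * sigma ^+ n)%:E)%E.
Proof.
move=> muM; have M0 : 0 <= M by exact: le_trans (mu0_ge0 0) (muM 0).
have mslab : measurable slab by exact: measurable_itv.
pose F (i : 'I_n) (t : R) := mu0 (sigma^-1 * (t - u 0 (lift ord0 i))).
have mF i : measurable_fun setT (F i).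
  apply: (measurableT_comp mmu0); apply: measurable_funM => //.
  exact: measurable_funB.
have mFprod : measurable_fun (setT : set (borelRow n))
    (fun w : 'rV[R]_n => (\prod_(i < n) F i (w 0 i))%:E).
  apply/measurable_EFinP; apply: measurable_prod => i _.
  by apply: (measurableT_comp (mF i)); exact: measurable_coord.
have Fint : iint (fun w : 'rV[R]_n => (\prod_(i < n) F i (w 0 i))%:E) = (sigma ^+ n)%:E.
  by apply: iint_prod => [i t|//|i]; [exact: mu0_ge0|exact: integral_mu0_affine].
have step t : iint (fun w : 'rV[R]_n =>
    (\1_slab (consrow t w 0 0) * proposal l u (consrow t w))%:E) =
    ((\1_slab t * mu0 (l * (sigma^-1 * (t - u 0 ord0))))%:E * (sigma ^+ n)%:E)%E.
  rewrite -Fint -iintZl//; last by rewrite mulr_ge0// indicE.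
  apply: eq_iint => w; rewrite consrow0 -EFinM -mulrA; congr (EFin (_ * _)).
  rewrite /proposal /prod_density big_ord_recl; congr (_ * _).
    by rewrite scale1_diffE eqxx consrow0.
  by apply: eq_bigr => i _; rewrite scale1_diffE consrowS mul1r.
rewrite /=; under eq_integral => t _ do rewrite step -EFinM.
apply: (@le_trans _ _ (\int[leb]_t ((M * sigma ^+ n)%:E * (\1_slab t)%:E))%E).
  have ml : measurable_fun setT (fun t : R => mu0 (l * (sigma^-1 * (t - u 0 ord0)))).
    apply: (measurableT_comp mmu0); do 2 apply: measurable_funM => //.
    exact: measurable_funB.
  have mi : measurable_fun setT (\1_slab : R -> R) by exact: measurable_indic.
  apply: ge0_le_integral => //.
  - by move=> t _; rewrite lee_fin !mulr_ge0 ?indicE// exprn_ge0 ?ltW.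
  - by apply/measurable_EFinP; apply: measurable_funM => //; exact: measurable_funM.
  - by apply: measurable_funeM; exact/measurable_EFinP.
  - move=> t _; rewrite -EFinM lee_fin mulrC [leRHS]mulrC.
    by rewrite mulrCA ler_wpM2l ?indicE// mulrC ler_wpM2r// exprn_ge0 ?ltW.
rewrite ge0_integralZl_EFin ?mulr_ge0 ?exprn_ge0 ?(ltW sigma_gt0)//.
- have slab1 : (leb slab = 1)%E.
    by rewrite lebesgue_measure_itv/= lte_fin ltr01 -EFinB subr0.
  by rewrite integral_indic// setIT [X in (_ * X)%E]slab1 mule1.
- by apply/measurable_EFinP; exact: measurable_indic.
Qed.

(* On the flow from [u] in the slab the bound [p v] of the minimum is used, on
   the flow towards [v] in the slab the bound [p u]; Tonelli and the symmetry of
   [mu0] identify the two resulting integrals. *)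
Lemma barker_form_slab_le (M : R) (a b : R) (l : R) : (forall t, mu0 t <= M) ->
  (barker_form p mu0 sigma l (fun u => if u 0%R 0%R \in slab then a else b)
   <= (2 * ((a - b) ^+ 2 * (2 / sigma) ^+ n.+1 * (M * sigma ^+ n)))%:E)%E.
Proof.
move=> muM; have M0 : 0 <= M by exact: le_trans (mu0_ge0 0) (muM 0).
have mslab : measurable slab by exact: measurable_itv.
set g := fun u : 'rV[R]_n.+1 => if u 0 0 \in slab then a else b.
have mg : measurable_fun (setT : set (borelRow n.+1)) g.
  apply: (@measurableT_comp _ _ _ _ _ _ (fun t : R => if t \in slab then a else b)).
    exact: measurable_two_valued.
  exact: measurable_coord.
set K := (a - b) ^+ 2 * (2 / sigma) ^+ n.+1.
have K0 : 0 <= K by rewrite mulr_ge0 ?sqr_ge0// exprn_ge0// divr_ge0// ltW.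
(* [h (u, v)] dominates the flow into the slab, [h (v, u)] the flow out of it. *)
pose h (z : borelRow n.+1 * borelRow n.+1) : \bar R :=
  ((K * p z.1)%:E * (\1_slab ((z.2 : 'rV[R]_n.+1) 0 0) * proposal l z.1 z.2)%:E)%E.
have mslab2 : measurable_fun setT (fun z : borelRow n.+1 * borelRow n.+1 =>
    (\1_slab ((z.2 : 'rV[R]_n.+1) 0 0) * proposal l z.1 z.2)%:E).
  apply/measurable_EFinP; apply: measurable_funM.
    apply: (@measurableT_comp _ _ _ _ _ _ (\1_slab : R -> R)).
      exact: measurable_indic.
    by apply: measurable_row_coord; exact: measurable_snd.
  exact: measurable_prod_density_diff.
have mh : measurable_fun setT h.
  apply: emeasurable_funM => //; apply/measurable_EFinP; apply: measurable_funM => //.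
  by apply: (measurableT_comp mp); exact: measurable_fst.
have mswap : measurable_fun setT (fun z : borelRow n.+1 * borelRow n.+1 => (z.2, z.1)).
  by apply: measurable_fun_pair; [exact: measurable_snd|exact: measurable_fst].
have mhs := measurableT_comp mh mswap.
have h0 z : (0 <= h z)%E.
  rewrite /h mule_ge0// lee_fin; first by rewrite mulr_ge0// ltW.
  by rewrite mulr_ge0 ?indicE// prod_density_ge0.
(* The inner integral is bounded uniformly in [u] up to the factor [p u], which integrates to 1. *)
have hint : (iint (fun u => iint (fun v => h (u, v))) <= (K * (M * sigma ^+ n))%:E)%E.
  apply: (@le_trans _ _ (iint (fun u => (K * (M * sigma ^+ n))%:E * (p u)%:E)%E)).
    apply: le_iint.
    - exact: measurable_parameter_iint mh.
    - by apply: measurable_funeM; exact/measurable_EFinP.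
    - by move=> u; exact: iint_ge0.
    move=> u; have Kp : 0 <= K * p u by rewrite mulr_ge0// ltW.
    rewrite (iintZl Kp (measurableT_comp mslab2 (pair1_measurable (u : borelRow n.+1)))).
    rewrite -EFinM [K * _ * p u]mulrAC [leRHS]EFinM.
    by apply: lee_wpmul2l; [rewrite lee_fin mulr_ge0// ltW|exact: slab_proposal_le].
  have KM : 0 <= K * (M * sigma ^+ n).
    by rewrite mulr_ge0// mulr_ge0// exprn_ge0// ltW.
  rewrite (iintZl KM); last exact/measurable_EFinP.
  by rewrite p_density.2.2 mule1.
have flow_le u v : (((g v - g u) ^+ 2 * barker_flow p mu0 sigma l u v)%:E
    <= h (u, v) + h (v, u))%E.
  have propN : proposal l v u = proposal l u v.
    rewrite /proposal -prod_densityN//; congr prod_density.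
    by apply/rowP => i; rewrite !mxE; case: ifP => _; rewrite -!mulrN opprB.
  rewrite /h/= propN -!EFinM -EFinD lee_fin.
  set D := proposal l u v; have D0 : 0 <= D by exact: prod_density_ge0.
  have minu : Num.min (p u * barker_weight p u v) (p v * barker_weight p v u) <= p u.
    by rewrite ge_min ler_piMr ?barker_weight_le1// ltW.
  have minv : Num.min (p u * barker_weight p u v) (p v * barker_weight p v u) <= p v.
    by rewrite ge_min (ler_piMr (ltW (p_gt0 v))) ?barker_weight_le1// orbT.
  rewrite /barker_flow -/(proposal l u v) -/D; set m := Num.min _ _ in minu minv *.
  have mE : (a - b) ^+ 2 * ((2 / sigma) ^+ n.+1 * D * m) = K * m * D.
    by rewrite -[_ * D * m]mulrA mulrA -/K [D * m]mulrC mulrA.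
  have Kp z : 0 <= K * p z by rewrite mulr_ge0// ltW.
  have Km z : m <= p z -> K * m * D <= K * p z * D.
    by move=> mz; apply: ler_wpM2r => //; exact: ler_wpM2l.
  (* The increment of [g] vanishes unless exactly one of [u], [v] is in the slab; then it is [a - b]
     up to sign. *)
  rewrite /g !indicE; case: (u 0 0 \in slab); case: (v 0 0 \in slab);
    rewrite ?(subrr, expr0n, mul0r, mul1r, mulr0, addr0, add0r) //.
  - by rewrite addr_ge0// mulr_ge0.
  - by rewrite -sqrrN opprB mE Km.
  - by rewrite mE Km.
apply: (@le_trans _ _ (iint (fun u => iint (fun v => h (u, v) + h (v, u))%E))).
  have mf := measurable_barker_form sigma pB lnp_C1 mmu0 l mg.
  have mD : measurable_fun setT (fun z : borelRow n.+1 * borelRow n.+1 =>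
      (h z + h (z.2, z.1))%E).
    exact: emeasurable_funD.
  apply: le_iint.
  - exact: measurable_parameter_iint mf.
  - exact: (measurable_parameter_iint mD).
  - by move=> u; apply: iint_ge0 => v; rewrite lee_fin mulr_ge0 ?sqr_ge0 ?barker_flow_ge0.
  move=> u; apply: le_iint => //.
  - exact: (measurableT_comp mf (pair1_measurable (u : borelRow n.+1))).
  - exact: (measurableT_comp mD (pair1_measurable (u : borelRow n.+1))).
  - by move=> v; rewrite lee_fin mulr_ge0 ?sqr_ge0 ?barker_flow_ge0.
rewrite (_ : (fun u => _) =
  (fun u => iint (fun v => h (u, v)) + iint (fun v => h (v, u)))%E); last first.
  apply/funext => u; rewrite iintD//.
  - exact: (measurableT_comp mh (pair1_measurable (u : borelRow n.+1))).
  - exact: (measurableT_comp mhs (pair1_measurable (u : borelRow n.+1))).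
rewrite iintD; last 4 first.
- exact: measurable_parameter_iint mh.
- exact: measurable_parameter_iint mhs.
- by move=> u; exact: iint_ge0.
- by move=> u; exact: iint_ge0.
rewrite [X in (_ + X)%E](iint_tonelli mhs (fun z => h0 (z.2, z.1))).
by rewrite mulr_natl mulr2n EFinD leeD.
Qed.

(** A single slab function, chosen for [p], is transported to every [l], so [a], [b] and [C] are
    independent of [l]. *)
Lemma barker_gap_upper (M : R) : (forall t, mu0 t <= M) ->
  exists C : R, forall l : R, 0 < l -> (barker_gap p mu0 sigma l <= (C * l)%:E)%E.
Proof.
move=> muM; have [a [b gL2]] := exists_slab_test_function p_density p_gt0.
have formC := fun l => barker_form_slab_le a b l muM.
set C := (2 * _) in formC; exists (2^-1 * C) => l l0.
have fL2 := L2_01_unscale pB l0 gL2.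
apply: le_trans (ereal_inf_lbound _) _; first by eexists; [exact: fL2|reflexivity].
rewrite (dirichletE l0 ((borel_funP _).1 fL2.1)).
under [X in barker_form _ _ _ _ X]eq_fun do rewrite scale1KV ?gt_eqF//.
rewrite [2^-1 * C * l]mulrAC [leRHS]EFinM; apply: lee_wpmul2l; last exact: formC.
by rewrite lee_fin mulr_ge0// ltW.
Qed.

End gap_bounds.

(* dimension d = n.+1 *)
Theorem theorem4p1 (R : realType) (n : nat) (p : 'rV[R]_n.+1 -> R) (mu0 : R -> R)
    (sigma : R) :
  prob_density p ->
  (forall x, 0 < p x) ->
  C1 (fun x => ln (p x)) ->
  measurable_fun setT mu0 ->
  (forall t, 0 <= mu0 t) ->
  (\int[@lebesgue_measure R]_t (mu0 t)%:E = 1)%E ->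
  (forall t, mu0 (- t) = mu0 t) ->
  (exists2 l0 : R, 0 < l0 & forall (x y : 'rV[R]_n.+1) (l : R), 0 < l < l0 ->
     prod_density mu0 (scale1 l (y - x)) >= prod_density mu0 (y - x)) ->
  (exists M : R, forall t, (@marginal1 R n (prod_density mu0) t <= M%:E)%E) ->
  0 < sigma ->
  (0 < barker_gap p mu0 sigma 1)%E ->
  (0 < limf_einf (fun l => barker_gap p mu0 sigma l * (l^-1)%:E) (0^'+))%E /\
  (limf_esup (fun l => barker_gap p mu0 sigma l * (l^-1)%:E) (0^'+) < +oo)%E.
Proof.
move=> p_density p_gt0 lnp_C1 mmu0 mu0_ge0 mu0_int mu0N [l0 l0_gt0 mono] [M muM].
move=> sigma_gt0 gap_gt0; split.
  (* The lower limit is a supremum of infima over neighbourhoods; on [0 < l < l0] the quotient is at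
     least the gap at [1]. *)
  rewrite limf_einfE; apply: lt_le_trans gap_gt0 _.
  apply: le_trans (ereal_sup_ubound _); last first.
    exists [set l : R | 0 < l < l0]; last by [].
    by near=> l; apply/andP; split; near: l; [exact: nbhs_right_gt|exact: nbhs_right_lt].
  apply: le_ereal_inf_tmp => _ [l /= ll0 <-]; have /andP[l_gt0 _] := ll0.
  rewrite lee_pdivlMr// muleC; apply: barker_gap_lower => // x.
  (* Starting from the origin, the difference of the two points is an arbitrary vector. *)
  by have := mono 0 x l ll0; rewrite subr0.
have [C gapC] := barker_gap_upper p_density p_gt0 lnp_C1 mmu0 mu0_ge0 mu0_int mu0N
  sigma_gt0 (mu0_bounded mmu0 mu0_ge0 mu0_int muM).
(* Dually, the supremum of the quotient over all [l > 0] is at most [C]. *)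
rewrite limf_esupE; apply: (@le_lt_trans _ _ C%:E); last exact: ltry.
apply: le_trans (ereal_inf_lbound _) _.
  exists [set l : R | 0 < l]; last reflexivity.
  exact: nbhs_right_gt.
apply: ge_ereal_sup => _ [l /= l_gt0 <-].
by rewrite lee_pdivrMr// -EFinM gapC.
Unshelve. all: by end_near. Qed.
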